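(* Given any Hermitian metric $\omega$ on an Inoue surface $S$, there exists a smooth real-valued function $\sigma$ on $S$ such that $\omega_{\mathrm{LF}}:=e^\sigma\omega$ is strongly flat along the leaves.
   Context: Let $H=\{z_2=x_2+\sqrt{-1}y_2 : y_2>0\}$ be the upper half plane, and let $(z_1,z_2)$ be the standard coordinates on $\mathbb{C}\times H$. An Inoue surface is a compact complex surface $S=(\mathbb{C}\times H)/\Gamma$ of one of the following three types (equivalently, a Class VII surface, i.e. a compact complex surface of negative Kodaira dimension with first Betti number one, with vanishing second Betti number and no holomorphic curves). In each case $\Gamma$ acts properly discontinuously with compact quotient. Type $S_M$: $M\in \mathrm{SL}(3,\mathbb{Z})$ has one real eigenvalue $\lambda>1$ and two complex eigenvalues $\mu\neq\overline{\mu}$; $(\ell_1,\ell_2,\ell_3)$ is a real eigenvector for $\lambda$ and $(m_1,m_2,m_3)$ an eigenvector for $\mu$; $\Gamma$ is generated by $f_0(z_1,z_2)=(\mu z_1,\lambda z_2)$ and $f_j(z_1,z_2)=(z_1+m_j,z_2+\ell_j)$, $1\le j\le 3$. Type $S^+$: $N=(n_{ij})\in\mathrm{SL}(2,\mathbb{Z})$ has two real eigenvalues $\kappa>1$ and $1/\kappa$, with real eigenvectors $(a_1,a_2)$ and $(b_1,b_2)$ respectively; $p,q,r$ are integers with $r\ne0$; $\mathbf{t}\in\mathbb{C}$; $(c_1,c_2)\in\mathbb{R}^2$ solves $(c_1,c_2)=(c_1,c_2)\cdot N^t+(e_1,e_2)+\frac{b_1a_2-b_2a_1}{r}(p,q)$,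 where $N^t$ is the transpose and $e_i=\frac12 n_{i1}(n_{i1}-1)a_1b_1+\frac12 n_{i2}(n_{i2}-1)a_2b_2+n_{i1}n_{i2}b_1a_2$; $\Gamma$ is generated by $f_0(z_1,z_2)=(z_1+\mathbf{t},\kappa z_2)$, $f_j(z_1,z_2)=(z_1+b_jz_2+c_j,z_2+a_j)$ for $j=1,2$, and $f_3(z_1,z_2)=(z_1+\frac{b_1a_2-b_2a_1}{r},z_2)$. Type $S^-$: $N=(n_{ij})\in\mathrm{GL}(2,\mathbb{Z})$ with $\det N=-1$ has real eigenvalues $\kappa>1$ and $-1/\kappa$, with real eigenvectors $(a_1,a_2)$ and $(b_1,b_2)$ respectively; $p,q,r\in\mathbb{Z}$, $r\neq0$; $(c_1,c_2)\in\mathbb{R}^2$ solves $-(c_1,c_2)=(c_1,c_2)\cdot N^t+(e_1,e_2)+\frac{b_1a_2-b_2a_1}{r}(p,q)$ with $e_i$ given by the same formula; $\Gamma$ is generated by $f_0(z_1,z_2)=(-z_1,\kappa z_2)$ and $f_1,f_2,f_3$ given by the same formulas as for $S^+$. Every surface of type $S^-$ has an unramified double cover of type $S^+$. Every Inoue surface carries a holomorphic foliation $\mathcal{F}$ without singularities whose leaves are the images of the slices $\mathbb{C}\times\{z_2\}$, $z_2\in H$, under the quotient map $\mathbb{C}\times H\to S$. A Hermitian metric $\omega$ on $S$ (identified with its positive $(1,1)$ form $\sqrt{-1}g_{i\overline j}dz_i\wedge d\overline z_j$) is called strongly flat along the leaves if there is a constant $c>0$ such that, after pullback to $\mathbb{C}\times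 H$, the restriction of $\omega$ to every slice $\mathbb{C}\times\{z_2\}$ equals $c\,(\mathrm{Im}\,z_2)\sqrt{-1}\,dz_1\wedge d\overline z_1$ when $S$ is of type $S_M$, and equals $c\,\sqrt{-1}\,dz_1\wedge d\overline z_1$ when $S$ is of type $S^+$ or $S^-$. *)

(* Defs.v *)
From HB Require Import structures.
From mathcomp Require Import all_boot all_order all_algebra.
From mathcomp Require Import all_classical all_reals all_analysis.
From mathcomp Require Import complex.

Set Implicit Arguments.
Unset Strict Implicit.
Unset Printing Implicit Defensive.

Import Order.TTheory GRing.Theory Num.Theory.
Import numFieldNormedType.Exports.

Local Open Scope classical_set_scope.
Local Open Scope ring_scope.
Local Open Scope complex_scope.

(* Indices are shifted by one: (z_1, z_2) is (z.1, z.2) for points, and the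
   entries v_1, v_2, .. of a vector are v 0 0, v 0 1, .. *)

Section Smooth.
Variable R : realType.

(* All partial derivatives of f of order at most k exist and are continuous
   at every point of U (which is meant to be open). *)
Fixpoint smooth_upto (n k : nat) (U : set 'rV[R]_n.+1) (f : 'rV[R]_n.+1 -> R)
    : Prop :=
  (forall x, U x -> {for x, continuous f}) /\
  if k is k'.+1 then
    forall i : 'I_n.+1,
      (forall x, U x -> derivable f x (delta_mx 0 i)) /\
      smooth_upto k' U ('D_(delta_mx 0 i) f)
  else True.

Definition smooth_on (n : nat) (U : set 'rV[R]_n.+1) (f : 'rV[R]_n.+1 -> R) :=
  forall k, smooth_upto k U f.

Definition C2 := (R[i] * R[i])%type.

(* The open set C x H of C^2; what functions on C^2 do outside of it is
   irrelevant throughout. *)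
Definition CH : set C2 := [set z | 0 < complex.Im z.2].

Definition of_coord (x : 'rV[R]_4) : C2 :=
  (x 0 0 +i* x 0 1, x 0 2%:R +i* x 0 3%:R).

Definition smooth_CH (f : C2 -> R) :=
  smooth_on (of_coord @^-1` CH) (f \o of_coord).

(* Complex Jacobian matrix (d f_k / d z_j)_{k,j} of f : C^2 -> C^2. *)
Definition jacobian_mx (f : C2 -> C2) (z : C2) : 'M[R[i]]_2 :=
  \matrix_(k, j)
    let coord (w : C2) : R[i]^o := if k == 0 then w.1 else w.2 in
    if j == 0 then derive1 (fun t : R[i]^o => coord (f (t, z.2))) z.1
    else derive1 (fun t : R[i]^o => coord (f (z.1, t))) z.2.

Definition conj_mx m n (A : 'M[R[i]]_(m, n)) := map_mx conjc A.

(* The form sqrt(-1) g_{i jbar} dz_i /\ d(zbar_j) is represented by its matrix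
   of coefficients (g_{i jbar}), a function of z. *)
Definition form11 := C2 -> 'M[R[i]]_2.

Definition pullback (f : C2 -> C2) (g : form11) : form11 := fun z =>
  (jacobian_mx f z)^T *m g (f z) *m conj_mx (jacobian_mx f z).

(* The group generated by F, a set of bijections of C^2. *)
Inductive generated_group (F : set (C2 -> C2)) : set (C2 -> C2) :=
| gen_id : generated_group F id
| gen_mem f : F f -> generated_group F f
| gen_comp f g :
    generated_group F f -> generated_group F g -> generated_group F (f \o g)
| gen_inv f g :
    generated_group F f -> cancel f g -> cancel g f -> generated_group F g.

End Smooth.

Definition eigenvector (K : fieldType) (n : nat) (A : 'M[int]_n) (k : K)
    (v : 'rV[K]_n) : Prop :=
  v != 0 /\ map_mx intr A *m v^T = k *: v^T.

Section Inoue.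
Variable R : realType.
Local Notation C2 := (C2 R).

(* Type S_M. Since mu is not real, its conjugate is the third eigenvalue
   of the integer matrix M. *)
Record SM_data := {
  SM_M : 'M[int]_3;
  SM_lambda : R;
  SM_mu : R[i];
  SM_l : 'rV[R]_3;
  SM_m : 'rV[R[i]]_3;
  SM_det : \det SM_M = 1;
  SM_lambda_gt1 : 1 < SM_lambda;
  SM_mu_conj : SM_mu != SM_mu^*;
  SM_eigen_l : eigenvector SM_M SM_lambda SM_l;
  SM_eigen_m : eigenvector SM_M SM_mu SM_m }.

Definition SM_generators (D : SM_data) : set (C2 -> C2) :=
  [set fun z => (SM_mu D * z.1, (SM_lambda D)%:C * z.2)] `|`
  [set f | exists j : 'I_3,
     f = fun z => (z.1 + SM_m D 0 j, z.2 + (SM_l D 0 j)%:C)].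

Definition e_vec (N : 'M[int]_2) (a b : 'rV[R]_2) : 'rV[R]_2 :=
  \row_i let n1 := (N i 0)%:~R in let n2 := (N i 1)%:~R in
    (2%:R^-1 * n1 * (n1 - 1) * a 0 0 * b 0 0
     + 2%:R^-1 * n2 * (n2 - 1) * a 0 1 * b 0 1
     + n1 * n2 * b 0 0 * a 0 1).

(* (b_1 a_2 - b_2 a_1) / r *)
Definition f3_step (a b : 'rV[R]_2) (r : int) : R :=
  (b 0 0 * a 0 1 - b 0 1 * a 0 0) / r%:~R.

Definition pq_vec (p q : int) : 'rV[R]_2 :=
  \row_i (if i == 0 then p%:~R else q%:~R).

Record Splus_data := {
  Sp_N : 'M[int]_2;
  Sp_kappa : R;
  Sp_a : 'rV[R]_2;
  Sp_b : 'rV[R]_2;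
  Sp_c : 'rV[R]_2;
  Sp_p : int;
  Sp_q : int;
  Sp_r : int;
  Sp_t : R[i];
  Sp_det : \det Sp_N = 1;
  Sp_kappa_gt1 : 1 < Sp_kappa;
  Sp_eigen_a : eigenvector Sp_N Sp_kappa Sp_a;
  Sp_eigen_b : eigenvector Sp_N (Sp_kappa^-1) Sp_b;
  Sp_r_neq0 : Sp_r != 0;
  Sp_eq_c : Sp_c = Sp_c *m (map_mx intr Sp_N)^T + e_vec Sp_N Sp_a Sp_b
                   + f3_step Sp_a Sp_b Sp_r *: pq_vec Sp_p Sp_q }.

Record Sminus_data := {
  Sm_N : 'M[int]_2;
  Sm_kappa : R;
  Sm_a : 'rV[R]_2;
  Sm_b : 'rV[R]_2;
  Sm_c : 'rV[R]_2;
  Sm_p : int;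
  Sm_q : int;
  Sm_r : int;
  Sm_det : \det Sm_N = -1;
  Sm_kappa_gt1 : 1 < Sm_kappa;
  Sm_eigen_a : eigenvector Sm_N Sm_kappa Sm_a;
  Sm_eigen_b : eigenvector Sm_N (- Sm_kappa^-1) Sm_b;
  Sm_r_neq0 : Sm_r != 0;
  Sm_eq_c : - Sm_c = Sm_c *m (map_mx intr Sm_N)^T + e_vec Sm_N Sm_a Sm_b
                     + f3_step Sm_a Sm_b Sm_r *: pq_vec Sm_p Sm_q }.

(* f_1, f_2 and f_3 for the types S^+ and S^- *)
Definition Spm_translations (a b c : 'rV[R]_2) (r : int)
    : set (C2 -> C2) :=
  [set f | exists j : 'I_2,
     f = fun z => (z.1 + (b 0 j)%:C * z.2 + (c 0 j)%:C, z.2 + (a 0 j)%:C)] `|`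
  [set fun z => (z.1 + (f3_step a b r)%:C, z.2)].

Definition Splus_generators (D : Splus_data) : set (C2 -> C2) :=
  [set fun z => (z.1 + Sp_t D, (Sp_kappa D)%:C * z.2)] `|`
  Spm_translations (Sp_a D) (Sp_b D) (Sp_c D) (Sp_r D).

Definition Sminus_generators (D : Sminus_data) : set (C2 -> C2) :=
  [set fun z => (- z.1, (Sm_kappa D)%:C * z.2)] `|`
  Spm_translations (Sm_a D) (Sm_b D) (Sm_c D) (Sm_r D).

Inductive inoue_surface :=
| Inoue_SM of SM_data
| Inoue_Splus of Splus_data
| Inoue_Sminus of Sminus_data.

Definition Gamma (S : inoue_surface) : set (C2 -> C2) :=
  generated_group
    (match S with
     | Inoue_SM D => SM_generators D
     | Inoue_Splus D => Splus_generators D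
     | Inoue_Sminus D => Sminus_generators D
     end).

(* The quotient map C x H -> S; points of S are the Gamma-orbits in C x H. *)
Definition orbit_of (S : inoue_surface) (z : C2) : set C2 :=
  [set w | exists2 f, Gamma S f & w = f z].

(* A function on S is a function of Gamma-orbits. The quotient map is a local
   diffeomorphism, so smoothness on S is smoothness of the pullback. *)
Definition smooth_on_surface (S : inoue_surface) (sigma : set C2 -> R) :=
  smooth_CH (sigma \o orbit_of S).

(* A Hermitian metric on S, given by its pullback to C x H: a smooth,
   Gamma-invariant, Hermitian positive definite (1,1) form. In R[i], 0 < x
   means that x is real and positive. *)
Definition hermitian_metric (S : inoue_surface) (g : form11 R) : Prop :=
  [/\ forall i j, smooth_CH (fun z => complex.Re (g z i j)) /\
                  smooth_CH (fun z => complex.Im (g z i j)),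
      forall z, CH z -> (g z)^T = conj_mx (g z),
      forall z, CH z -> forall v : 'rV[R[i]]_2, v != 0 ->
        0 < (v *m g z *m (conj_mx v)^T) 0 0
    & forall f, Gamma S f -> forall z, CH z -> pullback f g z = g z].

(* The restriction of the form to the slice C x {z_2} is
   sqrt(-1) g_{1 1bar} dz_1 /\ d(zbar_1), with coefficient g z 0 0. *)
Definition strongly_flat (S : inoue_surface) (g : form11 R) : Prop :=
  hermitian_metric S g /\
  exists2 c : R, 0 < c &
    forall z, CH z ->
      g z 0 0 = (match S with
                 | Inoue_SM _ => c * complex.Im z.2
                 | Inoue_Splus _ | Inoue_Sminus _ => c
                 end)%:C.

(* The pullback to C x H of e^sigma omega. *)
Definition conformal (S : inoue_surface) (sigma : set C2 -> R)
    (omega : form11 R) : form11 R :=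
  fun z => (expR (sigma (orbit_of S z)))%:C *: omega z.

End Inoue.

(* Main.v *)
Require Import Defs.
From mathcomp Require Import all_boot all_order all_algebra.
From mathcomp Require Import all_classical all_reals all_analysis.
From mathcomp Require Import complex ring.

Set Implicit Arguments.
Unset Strict Implicit.
Unset Printing Implicit Defensive.

Import Order.TTheory GRing.Theory Num.Theory.
Import numFieldNormedType.Exports.

Local Open Scope classical_set_scope.
Local Open Scope ring_scope.
Local Open Scope complex_scope.

(** The metric is flattened by dividing it by its own leafwise coefficient and
multiplying it by the prescribed one.
Write g for the coefficient g_{1 1bar} of the form on C x H; it is smooth and
positive.  Let h = Im z_2 for type S_M and h = 1 for types S^+ and S^-, and put
sigma = ln (h / g).  Then e^sigma omega has leafwise coefficient h, as wanted
with c = 1; the point is that h / g, which is smooth and positive on C x H,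
descends to S, i.e. is Gamma-invariant.

Every element of Gamma has the triangular affine form
  (z_1, z_2) |-> (a z_1 + b z_2 + c, d z_2 + e),   d > 0, e real,
with |a|^2 d^n = 1, where n = 1 for type S_M and n = 0 for the other two types.
Such maps are closed under composition and inversion
([leaf_affine_comp], [leaf_affine_inv]), so it is enough to look at the
generators ([Gamma_leaf_affine]).  For types S^+ and S^- this is immediate, as
a = 1 or a = -1.  For type S_M the condition on f_0 reads |mu|^2 lambda = 1:
mu, its conjugate and lambda are the three distinct eigenvalues of M, whose
product is det M = 1 ([SM_eigenvalues]).

The first coordinate of the pullback identity f^* omega = omega is
|a|^2 g (f z) = g z ([pullback_leaf_affine]), hence g (f z) = d^n g z; since
h = (Im z_2)^n also satisfies h (f z) = d^n h z, the quotient h / g is invariant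
([flattening_factor_invariant]).  Smoothness of h / g and of its logarithm
follows from the closure of C^k functions under products, inverses and
logarithms; smoothness being required on C x H only, functions may be replaced
by others that agree with them there ([eq_smooth_upto]). *)

(** * Real functions with continuous partial derivatives on an open set *)

(** Both sides only involve the restriction of f to the line through x directed
by v, so this is the chain rule in one variable. *)
Lemma is_derive_comp_real (R : realType) (V : normedModType R) (phi : R -> R)
    (f : V -> R) (x v : V) (dphi df : R) :
  is_derive (f x) 1 phi dphi -> is_derive x v f df ->
  is_derive x v (phi \o f) (dphi * df).
Proof.
pose line h := f (h *: v + x).
have line0 : line 0 = f x by rewrite /line scale0r add0r.
have Dline (g : V -> R) : 'D_v g x = (fun h : R => g (h *: v + x))^`()%classic 0.
  rewrite /derive /derive1; set F := fun h => _; set G := fun h => _.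
  suff -> : F = G by [].
  by apply/funext => h; rewrite /F /G /= addr0 scale0r add0r.
move=> [dphix <-] [dfx <-].
have dline : derivable line 0 1 by exact: (derivable1P _ _ _).1 dfx.
have dphiline : derivable phi (line 0) 1 by rewrite line0.
apply: DeriveDef.
  apply/derivable1P; rewrite -[fun h => _]/(phi \o line).
  by apply/derivable1_diffP/differentiable_comp; exact/derivable1_diffP.
by rewrite !Dline (derive1_comp dline dphiline) line0 derive1E.
Qed.

Section SmoothCalculus.
Variables (R : realType) (n : nat) (U : set 'rV[R]_n.+1).
Hypothesis openU : open U.
Implicit Types (f g df : 'rV[R]_n.+1 -> R) (k : nat).

Lemma smooth_upto_continuous k f x :
  smooth_upto k U f -> U x -> {for x, continuous f}.
Proof. by case: k => [|k] [cf _] Ux; apply: cf. Qed.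

Lemma smooth_upto_pred k f : smooth_upto k.+1 U f -> smooth_upto k U f.
Proof.
elim: k f => [|k IH] f [cf df]; first by split.
by split=> // i; split; [exact: (df i).1|apply: IH; exact: (df i).2].
Qed.

Lemma near_eq_on f g x : (forall y, U y -> f y = g y) -> U x ->
  \near x, f x = g x.
Proof.
move=> fg Ux; have : nbhs x U by exact: open_nbhs_nbhs.
by apply: filterS => y /fg.
Qed.

Lemma continuous_eq_on f g x : (forall y, U y -> f y = g y) -> U x ->
  {for x, continuous f} -> {for x, continuous g}.
Proof.
move=> fg Ux cf; have gf : g @ x `=>` f @ x.
  exact: near_eq_cvg (near_eq_on fg Ux).
by apply: (cvg_trans gf); rewrite -(fg x Ux); exact: cf.
Qed.

(** U being open, f and g have the same germ at each point of U, hence the same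
partial derivatives there; the induction then applies to these. *)
Lemma eq_smooth_upto k f g :
  (forall x, U x -> f x = g x) -> smooth_upto k U f -> smooth_upto k U g.
Proof.
elim: k f g => [|k IH] f g fg [cf df].
- by split=> // x Ux; exact: continuous_eq_on fg Ux (cf x Ux).
- split=> [x Ux|i]; first exact: continuous_eq_on fg Ux (cf x Ux).
  split=> [x Ux|].
    exact: near_eq_derivable (near_eq_on fg Ux) ((df i).1 x Ux).
  by apply: IH (df i).2 => x Ux; apply: near_eq_derive; exact: near_eq_on Ux.
Qed.

Lemma smooth_upto_is_derive k f i x : smooth_upto k.+1 U f -> U x ->
  is_derive x (delta_mx 0 i) f ('D_(delta_mx 0 i) f x).
Proof. by move=> [_ df] Ux; apply/derivableP; exact: (df i).1. Qed.

Lemma smooth_upto_derive k f i :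
  smooth_upto k.+1 U f -> smooth_upto k U ('D_(delta_mx 0 i) f).
Proof. by move=> [_ df]; exact: (df i).2. Qed.

(** The form in which smoothness is checked below: it suffices to exhibit
formulas for the partial derivatives which are valid on U alone. *)
Lemma smooth_uptoS k f (df : 'I_n.+1 -> 'rV[R]_n.+1 -> R) :
  (forall x, U x -> {for x, continuous f}) ->
  (forall i x, U x -> is_derive x (delta_mx 0 i) f (df i x)) ->
  (forall i, smooth_upto k U (df i)) -> smooth_upto k.+1 U f.
Proof.
move=> cf fdf sdf; split=> // i; split=> [x /(fdf i) //|].
by apply: eq_smooth_upto (sdf i) => x /(fdf i) [].
Qed.

Lemma smooth_upto_cst k (c : R) : smooth_upto k U (fun=> c).
Proof.
elim: k c => [|k IH] c; first by split=> // x _; apply: cst_continuous.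
apply: (@smooth_uptoS _ _ (fun _ _ => 0)).
- by move=> x _; exact: cst_continuous.
- by move=> i; exact: IH.
Qed.

Lemma smooth_upto_coord k (j : 'I_n.+1) : smooth_upto k U (fun x => x 0 j).
Proof.
case: k => [|k]; first by split=> // x _; apply: coord_continuous.
apply: (@smooth_uptoS _ _ (fun i _ => (delta_mx 0 i : 'rV[R]_n.+1) 0 j)).
- by move=> x _; apply: coord_continuous.
- move=> i x _; have did : derivable id x (delta_mx 0 i : 'rV[R]_n.+1).
    exact: derivable_id.
  apply: DeriveDef; first exact: (derivable_mxP _ _ _).1 did 0 j.
  by have /matrixP/(_ 0 j) := derive_mx did; rewrite derive_id !mxE => <-.
- by move=> i; apply: smooth_upto_cst.
Qed.

Lemma smooth_uptoD k f g :
  smooth_upto k U f -> smooth_upto k U g -> smooth_upto k U (f + g).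
Proof.
elim: k f g => [|k IH] f g sf sg.
all: have cfg x : U x -> {for x, continuous (f + g)}
  by move=> Ux; exact: cvgD (smooth_upto_continuous sf Ux)
     (smooth_upto_continuous sg Ux).
- by [].
- apply: (@smooth_uptoS _ _
    (fun i => 'D_(delta_mx 0 i) f + 'D_(delta_mx 0 i) g)) => // [i x Ux|i].
    exact: is_deriveD (smooth_upto_is_derive i sf Ux)
      (smooth_upto_is_derive i sg Ux).
  exact: IH (smooth_upto_derive i sf) (smooth_upto_derive i sg).
Qed.

(** By Leibniz' rule, the partial derivatives are built from products of C^k
functions when f and g are C^(k+1). *)
Lemma smooth_uptoM k f g :
  smooth_upto k U f -> smooth_upto k U g -> smooth_upto k U (f * g).
Proof.
elim: k f g => [|k IH] f g sf sg.
all: have cfg x : U x -> {for x, continuous (f * g)}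
  by move=> Ux; exact: cvgM (smooth_upto_continuous sf Ux)
     (smooth_upto_continuous sg Ux).
- by [].
- apply: (@smooth_uptoS _ _ (fun i =>
    f * 'D_(delta_mx 0 i) g + g * 'D_(delta_mx 0 i) f)) => // [i x Ux|i].
    exact: is_deriveM (smooth_upto_is_derive i sf Ux)
      (smooth_upto_is_derive i sg Ux).
  apply: smooth_uptoD.
    exact: IH (smooth_upto_pred sf) (smooth_upto_derive i sg).
  exact: IH (smooth_upto_pred sg) (smooth_upto_derive i sf).
Qed.

(** The derivative - f^-2 f' involves f^-1 itself, but one order of smoothness
lower, which is what the induction provides. *)
Lemma smooth_uptoV k f : (forall x, U x -> f x != 0) ->
  smooth_upto k U f -> smooth_upto k U (fun x => (f x)^-1).
Proof.
move=> f0; elim: k => [|k IH] sf.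
all: have cf x : U x -> {for x, continuous (fun x => (f x)^-1)}
  by move=> Ux; apply: cvgV (smooth_upto_continuous sf Ux); exact: f0.
- by [].
- have sV := IH (smooth_upto_pred sf).
  apply: (@smooth_uptoS _ _ (fun i => (fun=> -1) *
     ((fun x => (f x)^-1) * (fun x => (f x)^-1)) * 'D_(delta_mx 0 i) f)) => //.
    move=> i x Ux; have [dfx _] := smooth_upto_is_derive i sf Ux.
    apply: DeriveDef; first exact: derivableV (f0 x Ux) dfx.
    rewrite deriveV ?f0 // expr2 invfM; rewrite /GRing.scale /=.
    by rewrite /GRing.mul /= mulN1r.
  move=> i; apply: smooth_uptoM (smooth_upto_derive i sf).
  by apply: smooth_uptoM; [exact: smooth_upto_cst|exact: smooth_uptoM].
Qed.

Lemma smooth_upto_ln k f : (forall x, U x -> 0 < f x) ->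
  smooth_upto k U f -> smooth_upto k U (fun x => ln (f x)).
Proof.
move=> f0 sf.
have cln x : U x -> {for x, continuous (@ln R \o f)}.
  move=> Ux; apply: continuous_comp (smooth_upto_continuous sf Ux) _.
  exact/continuous_ln/f0.
case: k sf => [|k] sf //.
apply: (@smooth_uptoS _ _ (fun i => (fun x => (f x)^-1) *
   'D_(delta_mx 0 i) f)) => // [i x Ux|i].
  exact: is_derive_comp_real (is_derive1_ln (f0 x Ux))
    (smooth_upto_is_derive i sf Ux).
apply: smooth_uptoM (smooth_upto_derive i sf).
apply: smooth_uptoV (smooth_upto_pred sf) => x /f0.
exact: lt0r_neq0.
Qed.

End SmoothCalculus.

(** * Eigenvalues of integer matrices *)

Lemma eigenvector_map (K L : fieldType) (phi : {rmorphism K -> L}) n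
    (A : 'M[int]_n) (k : K) (v : 'rV[K]_n) :
  eigenvector A k v -> eigenvector A (phi k) (map_mx phi v).
Proof.
move=> [v0 Av]; split; first by rewrite map_mx_eq0.
rewrite matrix.map_trmx -map_mxZ -Av map_mxM; congr (_ *m _).
by apply/matrixP => i j; rewrite !mxE rmorph_int.
Qed.

Lemma eigenvector_root_char (K : fieldType) n (A : 'M[int]_n) (k : K)
    (v : 'rV[K]_n) :
  eigenvector A k v -> root (char_poly (map_mx intr A)^T) k.
Proof.
move=> [v0 Av]; rewrite -eigenvalue_root_char; apply/eigenvalueP; exists v => //.
by apply: trmx_inj; rewrite trmx_mul trmxK Av linearZ.
Qed.

(** Three distinct roots determine the monic characteristic polynomial of degree
three, whose constant coefficient is - det A. *)
Lemma det_eq_mul_eigenvalues3 (K : fieldType) (A : 'M[int]_3) (k1 k2 k3 : K)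
    (v1 v2 v3 : 'rV[K]_3) :
  uniq [:: k1; k2; k3] ->
  eigenvector A k1 v1 -> eigenvector A k2 v2 -> eigenvector A k3 v3 ->
  (\det A)%:~R = k1 * k2 * k3.
Proof.
move=> k_uniq /eigenvector_root_char r1 /eigenvector_root_char r2.
move=> /eigenvector_root_char r3; set p := char_poly _ in r1 r2 r3.
have p_fact : p = lead_coef p *: \prod_(k <- [:: k1; k2; k3]) ('X - k%:P).
  apply: all_roots_prod_XsubC; first by rewrite size_char_poly.
    by rewrite /= r1 r2 r3.
  by rewrite uniq_rootsE.
have := char_poly_det (map_mx intr A : 'M[K]_3)^T.
rewrite det_tr det_map_mx -/p p_fact (monicP (char_poly_monic _)) scale1r.
rewrite -horner_coef0 horner_prod !big_cons big_nil !hornerXsubC => e.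
by apply: oppr_inj; rewrite -mulN1r -[in LHS](_ : (-1) ^+ 3 = -1) -?e; ring.
Qed.

(** * The action of Gamma along the leaves *)

Section LeafAffine.
Variable R : realType.
Local Notation C2 := (C2 R).

(** M being real, conjugating an eigenvector for mu gives one for its conjugate;
this is the third eigenvalue, as mu is not real and lambda is. *)
Lemma SM_eigenvalues (D : SM_data R) :
  SM_mu D * (SM_mu D)^* * (SM_lambda D)%:C = 1.
Proof.
have lambda_mu (w : R[i]) : w != w^* -> (SM_lambda D)%:C != w.
  by apply: contra_neq => <-; rewrite conjc_real.
have mu_uniq : uniq [:: SM_mu D; (SM_mu D)^*; (SM_lambda D)%:C].
  rewrite /= !inE negb_or (SM_mu_conj D) ![_ == (SM_lambda D)%:C]eq_sym.
  by rewrite !lambda_mu // ?conjcK ?(SM_mu_conj D) // eq_sym (SM_mu_conj D).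
have em := SM_eigen_m D; have ec := eigenvector_map (@conjc R) em.
have el := eigenvector_map (real_complex R) (SM_eigen_l D).
by rewrite -(det_eq_mul_eigenvalues3 mu_uniq em ec el) SM_det.
Qed.

(** The condition on a and d says that the leafwise form (Im z_2)^n |dz_1|^2 is
preserved: |dz_1|^2 is scaled by |a|^2 on slices and Im z_2 is scaled by d. *)
Definition leaf_affine (n : nat) : set (C2 -> C2) :=
  [set f | exists (a b c : R[i]) (d e : R),
     [/\ 0 < d, a * a^* * (d ^+ n)%:C = 1
       & f = fun z => (a * z.1 + b * z.2 + c, d%:C * z.2 + e%:C)]].

Lemma leaf_affine_id n : leaf_affine n id.
Proof.
exists 1, 0, 0, 1, 0; split => //; first by rewrite expr1n rmorph1 !mulr1.
by apply/funext => -[z1 z2] /=; congr pair; rewrite ?rmorph1 ?rmorph0; ring.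
Qed.

Lemma leaf_affine_comp n f g :
  leaf_affine n f -> leaf_affine n g -> leaf_affine n (f \o g).
Proof.
move=> [a [b [c [d [e [d0 ad ->]]]]]] [a' [b' [c' [d' [e' [d0' ad' ->]]]]]].
exists (a * a'), (a * b' + b * d'%:C), (a * c' + b * e'%:C + c), (d * d'),
  (d * e' + e); split; first exact: mulr_gt0.
  rewrite exprMn !rmorphM /= -[RHS]mulr1 -{1}ad -ad'; ring.
by apply/funext => -[z1 z2] /=; congr pair; rewrite ?rmorphD ?rmorphM /=; ring.
Qed.

Lemma leaf_affine_inv n f g :
  leaf_affine n f -> cancel g f -> leaf_affine n g.
Proof.
move=> [a [b [c [d [e [d0 ad ->]]]]]] gK.
have a0 : a != 0.
  by apply: contra_eq_neq ad => ->; rewrite !mul0r eq_sym oner_eq0.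
have dC0 : d%:C != 0 by rewrite (fmorph_eq0 (real_complex R)) lt0r_neq0.
exists a^-1, (- (a^-1 * b * d%:C^-1)), (a^-1 * (b * d%:C^-1 * e%:C - c)),
  d^-1, (- (d^-1 * e)); split; first by rewrite invr_gt0.
  rewrite exprVn (fmorphV (@conjc R)) (fmorphV (real_complex R)).
  by rewrite -!invfM ad invr1.
apply/funext => w; rewrite -{2 3 4}[w]gK /=; case: (g w) => z1 z2 /=.
by congr pair; rewrite ?rmorphN ?rmorphM ?fmorphV /=; field; rewrite ?a0 ?dC0.
Qed.

(** The power of Im z_2 in the leafwise coefficient that is prescribed by strong
flatness. *)
Definition leaf_weight (S : inoue_surface R) : nat :=
  if S is Inoue_SM _ then 1 else 0.

Lemma Spm_translations_leaf_affine (a b c : 'rV[R]_2) (r : int) f :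
  Spm_translations a b c r f -> leaf_affine 0 f.
Proof.
move=> [[j ->]|->].
- exists 1, (b 0 j)%:C, (c 0 j)%:C, 1, (a 0 j); split => //.
    by rewrite rmorph1 !mulr1.
  by apply/funext => -[z1 z2] /=; rewrite rmorph1 !mul1r.
- exists 1, 0, (f3_step a b r)%:C, 1, 0; split => //.
    by rewrite rmorph1 !mulr1.
  by apply/funext => -[z1 z2] /=; rewrite !rmorph1 !mul1r mul0r !addr0.
Qed.

Lemma Gamma_leaf_affine S f : Gamma S f -> leaf_affine (leaf_weight S) f.
Proof.
elim=> [|{}f|f' g _ + _|f' g _ + _ gK]; first exact: leaf_affine_id.
- case: S => D [].
  + move=> ->; exists (SM_mu D), 0, 0, (SM_lambda D), 0; split.
    * exact: lt_trans ltr01 (SM_lambda_gt1 D).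
    * by rewrite expr1 SM_eigenvalues.
    * by apply/funext => -[z1 z2] /=; rewrite mul0r !addr0.
  + move=> [j ->]; exists 1, 0, (SM_m D 0 j), 1, (SM_l D 0 j); split => //.
      by rewrite expr1n rmorph1 !mulr1.
    by apply/funext => -[z1 z2] /=; rewrite rmorph1 !mul1r mul0r !addr0.
  + move=> ->; exists 1, 0, (Sp_t D), (Sp_kappa D), 0; split.
    * exact: lt_trans ltr01 (Sp_kappa_gt1 D).
    * by rewrite rmorph1 !mulr1.
    * by apply/funext => -[z1 z2] /=; rewrite mul1r mul0r !addr0.
  + exact: Spm_translations_leaf_affine.
  + move=> ->; exists (-1), 0, 0, (Sm_kappa D), 0; split.
    * exact: lt_trans ltr01 (Sm_kappa_gt1 D).
    * by rewrite rmorphN rmorph1 /= mulrNN !mulr1.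
    * by apply/funext => -[z1 z2] /=; rewrite mulN1r mul0r !addr0.
  + exact: Spm_translations_leaf_affine.
- exact: leaf_affine_comp.
- by move=> IHf; exact: leaf_affine_inv IHf gK.
Qed.

Lemma derive1_affine (a c x : R[i]) :
  derive1 (fun t : R[i]^o => a * t + c : R[i]^o) x = a.
Proof.
rewrite derive1E deriveD; first last.
- exact: derivable_cst.
- by apply: (@derivableM _ _ (cst a) id);
    [exact: derivable_cst|exact: derivable_id].
rewrite (@deriveM _ _ (cst a) id); [|exact: derivable_cst|exact: derivable_id].
by rewrite derive_id !derive_cst !scaler0 !addr0 [_ *: _]mulr1.
Qed.

(** Only the first column (a, 0) of the Jacobian matrix enters the coefficient
of dz_1 /\ dzbar_1. *)
Lemma pullback_leaf_affine (a b c : R[i]) (d e : R) (g : form11 R) z :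
  pullback (fun z => (a * z.1 + b * z.2 + c, d%:C * z.2 + e%:C)) g z 0 0 =
  a * a^* * g (a * z.1 + b * z.2 + c, d%:C * z.2 + e%:C) 0 0.
Proof.
rewrite /pullback; set f := fun z => _; set J := jacobian_mx f z.
have J00 : J 0 0 = a.
  rewrite mxE /=; under eq_fun do rewrite -addrA.
  exact: derive1_affine.
have J10 : J 1 0 = 0.
  by rewrite mxE /= derive1_cst.
clearbody J.
rewrite !mxE !big_ord_recl !big_ord0 /= !mxE !big_ord_recl !big_ord0 !mxE.
have -> : lift ord0 ord0 = 1 :> 'I_2 by apply/val_inj.
rewrite J00 J10 rmorph0; ring.
Qed.
End LeafAffine.

(** * Smooth functions on C x H *)

Section SmoothCH.
Variable R : realType.
Local Notation C2 := (C2 R).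
Implicit Types s t : C2 -> R.

Lemma open_CH_coord : open (@of_coord R @^-1` @CH R).
Proof.
rewrite (_ : _ @^-1` _ = (fun x : 'rV[R]_4 => x 0 3%:R) @^-1` [set y | 0 < y]).
  by apply: open_comp => [x _|]; [exact: coord_continuous|exact: open_gt].
by apply/seteqP; split.
Qed.

Lemma eq_smooth_CH s t :
  (forall z, CH z -> s z = t z) -> smooth_CH s -> smooth_CH t.
Proof.
move=> st ss k; apply: (eq_smooth_upto open_CH_coord) (ss k) => x.
exact: st.
Qed.

Lemma smooth_CH_Im : smooth_CH (fun z : C2 => complex.Im z.2).
Proof. by move=> k; exact: smooth_upto_coord open_CH_coord _ _. Qed.

Lemma smooth_CHM s t :
  smooth_CH s -> smooth_CH t -> smooth_CH (fun z => s z * t z).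
Proof.
by move=> ss st k; exact: smooth_uptoM open_CH_coord _ _ _ (ss k) (st k).
Qed.

Lemma smooth_CHX s m : smooth_CH s -> smooth_CH (fun z => s z ^+ m).
Proof.
move=> ss; elim: m => [|m IH].
  by move=> k; exact: smooth_upto_cst open_CH_coord _ _.
by apply: eq_smooth_CH (smooth_CHM ss IH) => z _; rewrite exprS.
Qed.

Lemma smooth_CHV s : (forall z, CH z -> s z != 0) -> smooth_CH s ->
  smooth_CH (fun z => (s z)^-1).
Proof.
by move=> s0 ss k; apply: (smooth_uptoV open_CH_coord) (ss k) => x; exact: s0.
Qed.

Lemma smooth_CH_ln s : (forall z, CH z -> 0 < s z) -> smooth_CH s ->
  smooth_CH (fun z => ln (s z)).
Proof.
by move=> s0 ss k; apply: (smooth_upto_ln open_CH_coord) (ss k) => x; exact: s0.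
Qed.
End SmoothCH.

(** * Normalizing the leafwise coefficient *)

Section Flattening.
Variables (R : realType) (S : inoue_surface R) (omega : form11 R).
Hypothesis omegaH : hermitian_metric S omega.
Local Notation C2 := (C2 R).

(** Positivity of the metric on the tangent vector (1, 0) of the leaf. *)
Lemma leaf_coef_gt0 z : CH z -> 0 < omega z 0 0.
Proof.
case: omegaH => _ _ pos _ /pos/(_ (delta_mx 0 0)).
have e00 : (delta_mx 0 0 : 'rV[R[i]]_2) != 0.
  by apply/eqP => /matrixP/(_ 0 0)/eqP; rewrite !mxE /= oner_eq0.
move=> /(_ e00); rewrite -rowE mxE !big_ord_recl big_ord0 !mxE /=.
by rewrite !oppr0 (mulr1 (omega z 0 0)) (mulr0 (omega z 0 _)) !addr0.
Qed.

Definition leaf_coef z : R := complex.Re (omega z 0 0).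

Lemma leaf_coefE z : CH z -> omega z 0 0 = (leaf_coef z)%:C.
Proof. by move=> /leaf_coef_gt0/gtr0_real/RRe_real. Qed.

Lemma Re_leaf_coef_gt0 z : CH z -> 0 < leaf_coef z.
Proof. by move=> zH; rewrite -ltcR -leaf_coefE // leaf_coef_gt0. Qed.

Definition flattening_factor (z : C2) : R :=
  complex.Im z.2 ^+ leaf_weight S / leaf_coef z.

Lemma flattening_factor_gt0 z : CH z -> 0 < flattening_factor z.
Proof. by move=> zH; rewrite divr_gt0 ?Re_leaf_coef_gt0 // exprn_gt0. Qed.

(** Numerator and denominator are both multiplied by d^n: the former because
Im z_2 is multiplied by d, the latter because |a|^2 = d^-n. *)
Lemma flattening_factor_invariant f z : Gamma S f -> CH z ->
  CH (f z) /\ flattening_factor (f z) = flattening_factor z.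
Proof.
move=> Gf zH; case: omegaH => _ _ _ /(_ f Gf z zH) /matrixP/(_ 0 0).
have [a [b [c [d [e [d0 ad ->]]]]]] := Gamma_leaf_affine Gf.
rewrite pullback_leaf_affine; set w := (_, _) => pull.
have ImE : complex.Im w.2 = d * complex.Im z.2.
  by rewrite /w /=; case: (z.2) => x y /=; ring.
have wH : CH w by rewrite /CH /= ImE mulr_gt0.
split=> //; rewrite /flattening_factor ImE.
have -> : leaf_coef w = d ^+ leaf_weight S * leaf_coef z.
  apply: complexI; rewrite rmorphM /= -!leaf_coefE // -pull.
  by rewrite mulrA [_ * (a * _)]mulrC ad mul1r.
rewrite exprMn; field.
by rewrite expf_neq0 ?lt0r_neq0 ?Re_leaf_coef_gt0.
Qed.

(** A function on the orbit space is obtained by evaluating at a chosen point of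
the orbit; by invariance the choice is immaterial for orbits inside C x H. *)
Definition flattening_log (O : set C2) : R :=
  ln (flattening_factor (xget (0, 0) O)).

Lemma flattening_logE z : CH z ->
  flattening_log (orbit_of S z) = ln (flattening_factor z).
Proof.
move=> zH; rewrite /flattening_log; case: xgetP => [w _|none].
  by case=> f Gf ->; rewrite (flattening_factor_invariant Gf zH).2.
by case: (none z); exists id => //; exact: gen_id.
Qed.

Lemma smooth_flattening_factor : smooth_CH flattening_factor.
Proof.
apply: smooth_CHM; first exact/smooth_CHX/smooth_CH_Im.
apply: smooth_CHV => [z zH|]; first by rewrite lt0r_neq0 ?Re_leaf_coef_gt0.
by case: omegaH => /(_ 0 0)[].
Qed.

Lemma smooth_flattening_log : smooth_on_surface S flattening_log.
Proof.
apply: eq_smooth_CH (smooth_CH_ln flattening_factor_gt0 smooth_flattening_factor).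
by move=> z zH; rewrite /= flattening_logE.
Qed.

Lemma conformal_flattening z : CH z ->
  conformal S flattening_log omega z = (flattening_factor z)%:C *: omega z.
Proof.
by move=> zH; rewrite /conformal flattening_logE // lnK // posrE
  flattening_factor_gt0.
Qed.

(** A positive smooth factor preserves smoothness, hermitian symmetry and
positivity; Gamma-invariance of the metric uses that of the factor. *)
Lemma conformal_flattening_hermitian :
  hermitian_metric S (conformal S flattening_log omega).
Proof.
case: omegaH => smooth herm pos inv; split=> [i j|z zH|z zH v v0|f Gf z zH].
- have [sRe sIm] := smooth i j; split.
    apply: eq_smooth_CH (smooth_CHM smooth_flattening_factor sRe) => z zH.
    by rewrite conformal_flattening // mxE; case: (omega z i j) => x y /=; ring.
  apply: eq_smooth_CH (smooth_CHM smooth_flattening_factor sIm) => z zH.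
  by rewrite conformal_flattening // mxE; case: (omega z i j) => x y /=; ring.
- rewrite conformal_flattening // linearZ /= herm // /conj_mx map_mxZ /=.
  by congr (_ *: _); rewrite -[LHS]conjc_real.
- rewrite conformal_flattening // -scalemxAr -scalemxAl mxE mulr_gt0 ?pos //.
  by rewrite (ltcR 0) flattening_factor_gt0.
- have [fzH fz] := flattening_factor_invariant Gf zH.
  rewrite conformal_flattening // -(inv f Gf z zH) /pullback.
  by rewrite conformal_flattening // fz -scalemxAr -scalemxAl.
Qed.

End Flattening.

Theorem proposition1p2 (R : realType) (S : inoue_surface R) (omega : form11 R)
    (homega : hermitian_metric S omega) :
  exists sigma : set (C2 R) -> R,
    smooth_on_surface S sigma /\ strongly_flat S (conformal S sigma omega).
Proof.
exists (flattening_log S omega); split; first exact: smooth_flattening_log.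
split; first exact: conformal_flattening_hermitian.
exists 1 => // z zH.
rewrite conformal_flattening // mxE (leaf_coefE homega zH) -rmorphM /=.
rewrite /flattening_factor divfK ?lt0r_neq0 ?(Re_leaf_coef_gt0 homega) //.
by congr (_%:C); case: S {homega zH} => D /=; rewrite ?expr1 ?mul1r ?expr0.
Qed.
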